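(* The classes $\mathcal{BDC}$ and $\mathcal{PCF}$ are closed under interleaved product. That is, if $\Sigma_1,\dots,\Sigma_r$ are finite alphabets and $L_i\subseteq\Sigma_i^*$, $i=1,\dots,r$, are languages all in $\mathcal{BDC}$ (respectively all in $\mathcal{PCF}$), then the interleaved product of $L_1,\dots,L_r$ is in $\mathcal{BDC}$ (respectively $\mathcal{PCF}$).
   Context: $\mathcal{BDC}$ denotes the Boolean closure of the class of deterministic context-free languages: a language over a finite alphabet $\Sigma$ is in $\mathcal{BDC}$ if it belongs to the smallest family of subsets of $\Sigma^*$ containing the deterministic context-free languages over $\Sigma$ and closed under finite union, finite intersection and complement. $\mathcal{PCF}$ denotes the class of poly-context-free languages, i.e. intersections of finitely many context-free languages over the same alphabet. Interleaved product: let $\Sigma_1,\dots,\Sigma_r$ be finite alphabets (with arbitrary overlaps), $L_i\subseteq\Sigma_i^*$, and $\Sigma=\bigcup_{i=1}^r\Sigma_i$. Let $\pi_i\colon\Sigma^*\to\Sigma_i^*$ be the monoid homomorphism with $\pi_i(a)=a$ if $a\in\Sigma_i$ and $\pi_i(a)=\varepsilon$ (the empty word) otherwise. The interleaved product of the $L_i$ is $L=\{w\in\Sigma^*:\pi_i(w)\in L_i,\ i=1,\dots,r\}$. *)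

(* Defs.v *)
From Stdlib Require Export Relation_Operators.
From mathcomp Require Export all_boot finmap.
From mathcomp Require Export boolp classical_sets.

Set Implicit Arguments.
Unset Strict Implicit.
Unset Printing Implicit Defensive.

Local Open Scope classical_set_scope.

(* Complements [~` L] of languages over [A] are taken in the set of all words. *)
Definition language (A : finType) := set (seq A).

(* A symbol of a sentential form is [inl X] (X a nonterminal) or [inr a] (a a
   terminal). *)
Record cfg (A : finType) := Cfg {
  cfg_nonterminal : finType;
  cfg_start : cfg_nonterminal;
  cfg_rules : seq (cfg_nonterminal * seq (cfg_nonterminal + A))
}.

Inductive cfg_step (A : finType) (G : cfg A) :
    seq (cfg_nonterminal G + A) -> seq (cfg_nonterminal G + A) -> Prop :=
| CfgStep u v X s : (X, s) \in cfg_rules G ->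
    cfg_step (u ++ inl X :: v) (u ++ s ++ v).

Definition cfg_language (A : finType) (G : cfg A) : language A :=
  [set w | clos_refl_trans _ (@cfg_step A G)
             [:: inl (cfg_start G)] (map inr w)].

Definition context_free (A : finType) (L : language A) : Prop :=
  exists G : cfg A, L = cfg_language G.

(* In [dpda_delta q x Z], the state is [q], the top stack symbol is [Z], and [x]
   is [Some a] for a move reading the letter [a] and [None] for an epsilon-move.
   Being option-valued, the transition function allows at most one move for each
   [(q, x, Z)]; [dpda_det] excludes a choice between an epsilon-move and a
   reading move. *)
Record dpda (A : finType) := Dpda {
  dpda_state : finType;
  dpda_stack : finType;
  dpda_start : dpda_state;
  dpda_bottom : dpda_stack;
  dpda_final : {set dpda_state};
  dpda_delta : dpda_state -> option A -> dpda_stack ->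
               option (dpda_state * seq dpda_stack);
  dpda_det : forall q Z, dpda_delta q None Z <> None ->
               forall a, dpda_delta q (Some a) Z = None
}.

(* State, unread input, stack with its top first. *)
Definition dpda_config (A : finType) (M : dpda A) : Type :=
  (dpda_state M * seq A * seq (dpda_stack M))%type.

Inductive dpda_step (A : finType) (M : dpda A) :
    dpda_config M -> dpda_config M -> Prop :=
| DpdaRead q a w Z g q' s : dpda_delta q (Some a) Z = Some (q', s) ->
    dpda_step (q, a :: w, Z :: g) (q', w, s ++ g)
| DpdaEps q w Z g q' s : dpda_delta q None Z = Some (q', s) ->
    dpda_step (q, w, Z :: g) (q', w, s ++ g).

(* Acceptance by final state; epsilon-moves are allowed after the last letter. *)
Definition dpda_language (A : finType) (M : dpda A) : language A :=
  [set w | exists (q : dpda_state M) (g : seq (dpda_stack M)),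
     q \in dpda_final M /\
     clos_refl_trans _ (@dpda_step A M)
       (dpda_start M, w, [:: dpda_bottom M]) (q, [::], g)].

Definition deterministic_context_free (A : finType) (L : language A) : Prop :=
  exists M : dpda A, L = dpda_language M.

Inductive BDC (A : finType) : language A -> Prop :=
| BDC_dcf L : deterministic_context_free L -> BDC L
| BDC_union L1 L2 : BDC L1 -> BDC L2 -> BDC (L1 `|` L2)
| BDC_inter L1 L2 : BDC L1 -> BDC L2 -> BDC (L1 `&` L2)
| BDC_compl L : BDC L -> BDC (~` L).

(* The empty intersection (n = 0) is the context-free language of all words. *)
Definition PCF (A : finType) (L : language A) : Prop :=
  exists (n : nat) (F : 'I_n -> language A),
    (forall i, context_free (F i)) /\ L = \bigcap_i F i.

(* Overlapping alphabets are finite sets of letters from a common type [K], and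
   a word over the alphabet [S] has type [seq S]. *)
Definition alphabet_union (K : choiceType) (r : nat)
    (Sigma : 'I_r -> {fset K}) : {fset K} :=
  (\bigcup_(i in 'I_r) Sigma i)%fset.

(* [insub] sends a letter outside [S] to [None], which [pmap] erases. *)
Definition proj (K : choiceType) (U S : {fset K}) (w : seq U) : seq S :=
  pmap (fun a : U => insub (val a)) w.

Definition interleaved_product (K : choiceType) (r : nat)
    (Sigma : 'I_r -> {fset K}) (L : forall i, language (Sigma i)) :
    language (alphabet_union Sigma) :=
  [set w | forall i, L i (proj (Sigma i) w)].

(* Main.v *)
(* Erasing the letters outside [S] is a map [pmap f] for a partial map [f] on
   letters, and the interleaved product is the intersection of the preimages of
   the [L i]. Preimages commute with Boolean operations, so it suffices that
   preimages under [pmap f] preserve context-freeness and determinism.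
   For a grammar, each terminal [a] is replaced by a nonterminal deriving the
   letters above [a] followed by erased letters. For a dpda [M], simulating [M]
   naively fails: [M] may accept in the middle of an infinite sequence of
   epsilon-moves, or with an empty stack, when erased letters remain to be read.
   Instead, the epsilon-moves of [M] are delayed until the next letter has been
   read, and each stack symbol carries the set of states from which [M] with the
   stack below it can reach a final state by epsilon-moves only. *)
Require Import Defs.
From mathcomp Require Import all_boot finmap.
From mathcomp Require Import boolp classical_sets.

Set Implicit Arguments.
Unset Strict Implicit.
Unset Printing Implicit Defensive.

Local Open Scope classical_set_scope.

(** * Preimages of context-free languages *)

Section CfgPreimage.
Variables (U S : finType) (f : U -> option S) (G : cfg S).

Let N := cfg_nonterminal G.

(* [None] is the new start symbol; [Some (inr None)] derives the erased words;
   [Some (inr (Some a))] derives the letters above [a], each followed by an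
   erased word. *)
Definition pre_nonterminal : finType := option (N + option S).

Definition pre_block (o : option S) : pre_nonterminal + U :=
  inl (Some (inr o)).

Definition pre_symbol (x : N + S) : pre_nonterminal + U :=
  match x with
  | inl X => inl (Some (inl X))
  | inr a => pre_block (Some a)
  end.

Definition pre_rules : seq (pre_nonterminal * seq (pre_nonterminal + U)) :=
  (None, [:: pre_block None; pre_symbol (inl (cfg_start G))])
  :: (Some (inr None), [::])
  :: [seq (Some (inr (f b)), [:: inr b; pre_block None]) | b <- enum U]
  ++ [seq (Some (inl r.1), map pre_symbol r.2) | r <- cfg_rules G].

Definition pre_cfg : cfg U := @Cfg U pre_nonterminal None pre_rules.

Definition image_symbol (x : pre_nonterminal + U) : seq (N + S) :=
  match x with
  | inl None => [:: inl (cfg_start G)]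
  | inl (Some (inl X)) => [:: inl X]
  | inl (Some (inr o)) => map inr (seq_of_opt o)
  | inr b => map inr (seq_of_opt (f b))
  end.

Definition image_form (t : seq (pre_nonterminal + U)) : seq (N + S) :=
  flatten (map image_symbol t).

Lemma image_form_cat t1 t2 :
  image_form (t1 ++ t2) = image_form t1 ++ image_form t2.
Proof. by rewrite /image_form map_cat flatten_cat. Qed.

Lemma image_form_word w : image_form (map inr w) = map inr (pmap f w).
Proof.
rewrite /image_form; elim: w => //= b w ->.
by case: (f b).
Qed.

Lemma image_form_pre_symbol s : image_form (map pre_symbol s) = s.
Proof. by rewrite /image_form; elim: s => //= -[X|a] s /= ->. Qed.

(** Under [image_form] the two sides of each rule of [pre_cfg] coincide, except for the copied rules
    of [G], which become one step of [G]. *)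
Lemma image_form_step t1 t2 : @cfg_step U pre_cfg t1 t2 ->
  clos_refl_trans _ (@cfg_step S G) (image_form t1) (image_form t2).
Proof.
case=> u v X s; rewrite -cat1s !image_form_cat.
rewrite /= !inE mem_cat => /or3P[/eqP[-> ->]|/eqP[-> ->]|/orP[]].
- exact: rt_refl.
- exact: rt_refl.
- move=> /mapP[b _ [-> ->]].
  by rewrite /image_form /= cats0; apply: rt_refl.
- move=> /mapP[[Y t] rY [-> ->]].
  rewrite image_form_pre_symbol /=; apply: rt_step; exact: CfgStep rY.
Qed.

Lemma pre_symbol_step x t1 t2 : @cfg_step S G t1 t2 ->
  @cfg_step U pre_cfg (x :: map pre_symbol t1) (x :: map pre_symbol t2).
Proof.
case=> u v X s rX; rewrite !map_cat -!cat_cons.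
apply: CfgStep; rewrite /= !inE mem_cat; apply/orP; right; apply/orP; right.
by apply/orP; right; apply/mapP; exists (X, s).
Qed.

Lemma pre_block_step u v b :
  @cfg_step U pre_cfg (u ++ pre_block (f b) :: v)
    (u ++ [:: inr b; pre_block None] ++ v).
Proof.
apply: CfgStep; rewrite /= !inE mem_cat map_f ?mem_enum //.
by rewrite /= !orbT.
Qed.

Lemma pre_block_erase u v :
  @cfg_step U pre_cfg (u ++ pre_block None :: v) (u ++ v).
Proof.
by apply: (@CfgStep _ pre_cfg u v _ [::]); rewrite /= !inE eqxx orbT.
Qed.

(** The block [pre_block None] acts as a cursor moving right. It emits an erased letter itself;
    before a letter above [a] it vanishes, and [pre_block (Some a)] emits that letter with a fresh
    cursor behind it. *)
Lemma pre_blocks_derive u w :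
  clos_refl_trans _ (@cfg_step U pre_cfg)
    (u ++ pre_block None :: map pre_symbol (map inr (pmap f w)))
    (u ++ map inr w).
Proof.
elim: w u => [|b w IHw] u; first by apply: rt_step; apply: pre_block_erase.
move: (IHw (rcons u (inr b))); rewrite !cat_rcons /= => {}IHw.
apply: rt_trans IHw.
have := fun v => pre_block_step u v b.
case: (f b) => [a|] /= step; last by apply: rt_step; apply: step.
apply: rt_trans (rt_step _ _ _ _ (pre_block_erase _ _)) _.
by apply: rt_step; apply: step.
Qed.

Lemma pre_cfg_language :
  cfg_language pre_cfg = pmap f @^-1` cfg_language G.
Proof.
apply/seteqP; split=> w /= derw.
- change (clos_refl_trans _ (@cfg_step S G)
    [:: inl (cfg_start G)] (map inr (pmap f w))).
  rewrite -image_form_word.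
  have -> : [:: inl (cfg_start G)] = image_form [:: inl None] by [].
  elim: derw => [t1 t2|t|t1 t2 t3 _ IH12 _ IH23].
  + exact: image_form_step.
  + exact: rt_refl.
  + exact: rt_trans IH12 IH23.
(* The derivation in [G] is copied first, behind the initial erasing block; only then are the blocks
   expanded into letters. *)
- apply: rt_trans (pre_blocks_derive [::] w).
  have start := @CfgStep U pre_cfg [::] [::] _ _ (mem_head _ _).
  apply: rt_trans (rt_step _ _ _ _ start) _.
  change (clos_refl_trans _ (@cfg_step U pre_cfg)
    (pre_block None :: map pre_symbol [:: inl (cfg_start G)])
    (pre_block None :: map pre_symbol (map inr (pmap f w)))).
  elim: derw => [t1 t2 step|t|t1 t2 t3 _ IH12 _ IH23].
  + exact/rt_step/pre_symbol_step.
  + exact: rt_refl.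
  + exact: rt_trans IH12 IH23.
Qed.

End CfgPreimage.

Lemma context_free_preimage (U S : finType) (f : U -> option S)
    (L : language S) :
  context_free L -> context_free (pmap f @^-1` L).
Proof.
by move=> [G ->]; exists (pre_cfg f G); rewrite pre_cfg_language.
Qed.

(** * Acceptance by epsilon-moves and its dependence on the stack *)

Section DpdaRuns.
Variables (A : finType) (M : dpda A).

Lemma dpda_step_inv q w g c : dpda_step (M := M) (q, w, g) c ->
  exists Z g' q' s, g = Z :: g' /\
  (dpda_delta q None Z = Some (q', s) /\ c = (q', w, s ++ g') \/
   exists a w', [/\ w = a :: w', dpda_delta q (Some a) Z = Some (q', s) &
                    c = (q', w', s ++ g')]).
Proof.
move eq_c0: (q, w, g) => c0 step.
case: step eq_c0 => [q0 a w' Z g' q' s qZ|q0 w' Z g' q' s qZ] [-> -> ->];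
  exists Z, g', q', s; split=> //; [right; exists a, w'|left]; by [].
Qed.

(** Accepting runs unrolled from the front, so that induction peels off the first move. *)
Inductive dpda_accepts : dpda_config M -> Prop :=
| DpdaAcceptsFinal q g : q \in dpda_final M -> dpda_accepts (q, [::], g)
| DpdaAcceptsStep c c' :
    dpda_step c c' -> dpda_accepts c' -> dpda_accepts c.

Lemma dpda_languageE :
  dpda_language M =
  [set w | dpda_accepts (dpda_start M, w, [:: dpda_bottom M])].
Proof.
apply/seteqP; split=> w; rewrite /dpda_language /=.
- move=> [q [g [qF run]]]; have := DpdaAcceptsFinal g qF.
  elim: run => // [c1 c2 c12|c1 c2 c3 _ IH12 _ IH23 /IH23 //].
  exact: DpdaAcceptsStep.
- elim=> [q g qF|c1 c2 c12 _ [q [g [qF run]]]].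
  + by exists q, g; split=> //; apply: rt_refl.
  + exists q, g; split=> //; exact: rt_trans (rt_step _ _ _ _ c12) run.
Qed.

Definition dpda_eps_accepts q g := dpda_accepts (q, [::], g).

(* [dpda_eps_to q g p]: epsilon-moves lead from [q] to [p], popping all of [g]. *)
Inductive dpda_eps_to : dpda_state M -> seq (dpda_stack M) ->
    dpda_state M -> Prop :=
| DpdaEpsToNil q : dpda_eps_to q [::] q
| DpdaEpsToCons q Z g q' s p : dpda_delta q None Z = Some (q', s) ->
    dpda_eps_to q' (s ++ g) p -> dpda_eps_to q (Z :: g) p.

(** A run either accepts before it uses any symbol of [g], or first pops exactly [h], reaching some
    state [p] with stack [g]. *)
Lemma dpda_eps_accepts_cat q h g :
  dpda_eps_accepts q (h ++ g) <->
  dpda_eps_accepts q h \/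
  exists2 p, dpda_eps_accepts p g & dpda_eps_to q h p.
Proof.
split.
- rewrite /dpda_eps_accepts; remember (q, [::], h ++ g) as c eqn:ec => acc.
  elim: acc q h ec => [q g' qF|c1 c2 c12 acc2 IH] q' h.
    by move=> [<- _]; left; apply: DpdaAcceptsFinal.
  case: h => [|Z h] ec.
    right; exists q'; last exact: DpdaEpsToNil.
    by rewrite -ec; apply: DpdaAcceptsStep acc2.
  move: c12; rewrite ec => /dpda_step_inv[_ [_ [q1 [s [[<- <-]]]]]].
  case=> [[qZ ec2]|[? [? [//]]]]; move: acc2 IH; rewrite {}ec2 => acc2 IH.
  have [|acc|[p pg qp]] := IH q1 (s ++ h); first by rewrite catA.
  + by left; apply: DpdaAcceptsStep acc; apply: DpdaEps.
  + by right; exists p => //; apply: DpdaEpsToCons qZ qp.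
- case=> [|[p pg qp]].
  + rewrite /dpda_eps_accepts; remember (q, [::], h) as c eqn:ec => acc.
    elim: acc q h ec => [q g' qF|c1 c2 c12 acc2 IH] q' h ec.
      by case: ec => <- _; apply: DpdaAcceptsFinal.
    move: c12 IH; rewrite ec => /dpda_step_inv[Z [h' [q1 [s [->]]]]].
    case=> [[qZ ->]|[? [? [//]]]] IH.
    apply: (DpdaAcceptsStep (c' := (q1, [::], s ++ (h' ++ g)))).
      exact: DpdaEps.
    by rewrite catA; apply: IH.
  + elim: qp pg => // {}q Z h' q' s {}p qZ _ IH /IH acc.
    apply: (DpdaAcceptsStep (c' := (q', [::], s ++ (h' ++ g)))).
      exact: DpdaEps.
    by rewrite catA.
Qed.

Definition dpda_accset g : {set dpda_state M} :=
  [set q | `[< dpda_eps_accepts q g >]].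

(** The update depends on the lower stack only through the finite set [B], so a finite stack
    alphabet can carry it. *)
Definition dpda_accset_cons Z (B : {set dpda_state M}) : {set dpda_state M} :=
  [set q | `[< dpda_eps_accepts q [:: Z] \/
               exists2 p, p \in B & dpda_eps_to q [:: Z] p >]].

Lemma dpda_accsetP q g : q \in dpda_accset g <-> dpda_eps_accepts q g.
Proof. by rewrite inE; split=> /asboolP. Qed.

Lemma dpda_accset_consE Z g :
  dpda_accset_cons Z (dpda_accset g) = dpda_accset (Z :: g).
Proof.
apply/setP => q; apply/idP/idP; rewrite inE => /asboolP.
- move=> acc; apply/dpda_accsetP; apply/(dpda_eps_accepts_cat q [:: Z] g).
  by case: acc => [|[p /dpda_accsetP pg qp]]; [left|right; exists p].
- move=> /(dpda_eps_accepts_cat q [:: Z] g) acc; rewrite inE; apply/asboolP.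
  by case: acc => [|[p pg qp]]; [left|right; exists p => //; apply/dpda_accsetP].
Qed.

Lemma dpda_accset_cat s g :
  foldr dpda_accset_cons (dpda_accset g) s = dpda_accset (s ++ g).
Proof. by elim: s => //= Z s ->; rewrite dpda_accset_consE. Qed.

End DpdaRuns.

(** * Preimages of deterministic context-free languages *)

Section DpdaPreimage.
Variables (U S : finType) (f : U -> option S) (M : dpda S).

Let Q := dpda_state M.

(* [None] is the initial state. In [Some (q, inl a)], the letter [a] has been
   read but not yet passed to [M]. In [Some (q, inr b)], the bit [b] says
   whether [M] accepts from the current configuration by epsilon-moves. *)
Definition pre_state : finType := option (Q * (S + bool)).

(* [None] is a bottom marker, never removed. *)
Definition pre_stack : finType := option (dpda_stack M * {set Q}).

Fixpoint pre_annot (B : {set Q}) (s : seq (dpda_stack M)) : seq pre_stack :=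
  if s is Z :: s' then
    Some (Z, foldr (@dpda_accset_cons S M) B s') :: pre_annot B s'
  else [::].

(** States with a bit only read, and states with a pending letter only make epsilon-moves, which
    gives determinism. Passing the pending letter to [M] is itself an epsilon-move here. *)
Definition pre_delta (p : pre_state) (x : option U) (Y : pre_stack) :
    option (pre_state * seq pre_stack) :=
  match p, x, Y with
  | None, None, None =>
      Some (Some (dpda_start M,
                  inr (dpda_start M \in dpda_accset [:: dpda_bottom M])),
            rcons (pre_annot (dpda_accset [::]) [:: dpda_bottom M]) None)
  | Some (q, inr b), Some u, _ =>
      Some (Some (q, if f u is Some a then inl a else inr b), [:: Y])
  | Some (q, inl a), None, Some (Z, B) =>
      if dpda_delta q None Z is Some (q', s) then
        Some (Some (q', inl a), pre_annot B s)
      else if dpda_delta q (Some a) Z is Some (q', s) then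
        Some (Some (q', inr (q' \in foldr (@dpda_accset_cons S M) B s)),
              pre_annot B s)
      else None
  | _, _, _ => None
  end.

Lemma pre_delta_det p Y :
  pre_delta p None Y <> None -> forall u, pre_delta p (Some u) Y = None.
Proof. by case: p => [[q [a|b]]|]. Qed.

Definition pre_dpda : dpda U :=
  @Dpda U pre_state pre_stack None None
    [set p | if p is Some (_, inr b) then b else false] pre_delta pre_delta_det.

Definition pre_encode (g : seq (dpda_stack M)) : seq pre_stack :=
  rcons (pre_annot (dpda_accset [::]) g) None.

Lemma pre_encode_cons Z g :
  pre_encode (Z :: g) = Some (Z, dpda_accset g) :: pre_encode g.
Proof. by rewrite /pre_encode /= dpda_accset_cat cats0. Qed.

Lemma pre_encode_cat s g :
  pre_encode (s ++ g) = pre_annot (dpda_accset g) s ++ pre_encode g.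
Proof.
by elim: s => //= Z s IH; rewrite pre_encode_cons IH dpda_accset_cat.
Qed.

Definition pre_idle q g w : dpda_config pre_dpda :=
  (Some (q, inr (q \in dpda_accset g)), w, pre_encode g).

Definition pre_pending q a g w : dpda_config pre_dpda :=
  (Some (q, inl a), w, pre_encode g).

Lemma pre_idle_read q g u w :
  dpda_step (pre_idle q g (u :: w))
    (if f u is Some a then pre_pending q a g w else pre_idle q g w).
Proof.
rewrite /pre_idle /pre_pending.
(* The bottom marker provides a top symbol even when [g] is empty. *)
case eg: (pre_encode g) => [|Y h]; first by case: (g) eg.
have: pre_delta (Some (q, inr (q \in dpda_accset g))) (Some u) Y =
  Some (Some (q, if f u is Some a then inl a else inr (q \in dpda_accset g)),
        [:: Y]) by [].
by case: (f u) => [a|] dY; apply: (DpdaRead (M := pre_dpda)) dY.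
Qed.

Lemma pre_pending_eps q a Z g w q' s :
  dpda_delta q None Z = Some (q', s) ->
  dpda_step (pre_pending q a (Z :: g) w) (pre_pending q' a (s ++ g) w).
Proof.
move=> qZ; rewrite /pre_pending pre_encode_cons pre_encode_cat.
by apply: DpdaEps; rewrite /= qZ.
Qed.

Lemma pre_pending_read q a Z g w q' s :
  dpda_delta q (Some a) Z = Some (q', s) ->
  dpda_step (pre_pending q a (Z :: g) w) (pre_idle q' (s ++ g) w).
Proof.
move=> qZ; rewrite /pre_pending /pre_idle pre_encode_cons pre_encode_cat.
apply: DpdaEps => /=; rewrite qZ dpda_accset_cat.
(* [pre_delta] tries the epsilon-move of [M] first; by determinism there is none where [M] can read
   [a]. *)
case qN: (dpda_delta q None Z) => [x|//].
have /(@dpda_det _ M)/(_ a) : dpda_delta q None Z <> None by rewrite qN.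
by rewrite qZ.
Qed.

Lemma pre_dpda_sound c : dpda_accepts c ->
  (forall q g w, c = pre_idle q g w -> dpda_accepts (q, pmap f w, g)) /\
  (forall q a g w, c = pre_pending q a g w ->
     dpda_accepts (q, a :: pmap f w, g)).
Proof.
elim=> [p h pF|c1 c2 c12 _ [IHidle IHpending]].
  split=> [q g w [ep <- _]|q a g w [ep _ _]].
  (* A final state has its bit true, and the bit is membership in [dpda_accset g]. *)
  + by apply/dpda_accsetP; move: pF; rewrite ep inE.
  + by move: pF; rewrite ep inE.
split=> [q g w ec|q a g w ec]; move: c12; rewrite {}ec.
- move=> /dpda_step_inv[Y [h [p [s [eg]]]]].
  case=> [[]//|[u [w' [ew]]]]; rewrite ew /= => -[<- <-] {p s} /=.
  rewrite -eg; case: (f u) => [a|]; first exact: IHpending.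
  exact: IHidle.
- case: g => [|Z g] /dpda_step_inv[Y [h [p [s []]]]].
    by move=> [<- _] [[]//|[? [? []]]].
  rewrite -/(pre_encode (Z :: g)) pre_encode_cons => -[<- <-] {Y h}.
  case=> [[/=]|[? [? []//]]].
  case qN: (dpda_delta q None Z) => [[q1 s1]|].
    move=> [<- <-] ec2; apply: DpdaAcceptsStep (DpdaEps _ _ qN) _.
    by apply: IHpending; rewrite ec2 /pre_pending pre_encode_cat.
  case qa: (dpda_delta q (Some a) Z) => [[q1 s1]|//].
  move=> [<- <-] ec2; apply: DpdaAcceptsStep (DpdaRead _ _ qa) _.
  by apply: IHidle; rewrite ec2 /pre_idle pre_encode_cat dpda_accset_cat.
Qed.

(** Erased letters are skipped by induction on [w]. The second hypothesis takes over at the first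
    letter that is kept; it is supplied by the induction in [pre_pending_complete]. *)
Lemma pre_idle_complete q g w :
  dpda_accepts (q, pmap f w, g) ->
  (forall a v, a :: pmap f v = pmap f w -> dpda_accepts (pre_pending q a g v)) ->
  dpda_accepts (pre_idle q g w).
Proof.
elim: w => [|u w IH] /= acc pend.
  apply: DpdaAcceptsFinal; rewrite inE; exact/dpda_accsetP.
apply: DpdaAcceptsStep (pre_idle_read q g u w) _.
by case: (f u) acc pend => [a|] /= acc pend; [apply: pend|apply: IH].
Qed.

(** Induction on the run of [M]: with a letter still unread it cannot have ended, and each of its
    moves up to reading [a] is matched by one move. *)
Lemma pre_pending_complete c : dpda_accepts c ->
  forall q a g w, c = (q, a :: pmap f w, g) ->
  dpda_accepts (pre_pending q a g w).
Proof.
elim=> // c1 c2 c12 acc2 IH q a g w ec; move: c12; rewrite {}ec.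
move=> /dpda_step_inv[Z [h [q' [s [-> [[qZ ec2]|[b [v [[<- <-] qZ ec2]]]]]]]]].
- by apply: DpdaAcceptsStep (pre_pending_eps _ _ _ qZ) _; apply: IH.
- apply: DpdaAcceptsStep (pre_pending_read _ _ qZ) _; rewrite ec2 in acc2.
  by apply: pre_idle_complete acc2 _ => a' u eu; apply: IH; rewrite eu.
Qed.

Lemma pre_dpda_language :
  dpda_language pre_dpda = pmap f @^-1` dpda_language M.
Proof.
have init w : dpda_step (dpda_start pre_dpda, w, [:: dpda_bottom pre_dpda])
    (pre_idle (dpda_start M) [:: dpda_bottom M] w).
  exact: (@DpdaEps U pre_dpda None w None [::] _ _ erefl).
rewrite !dpda_languageE; apply/seteqP; split=> w /= acc.
- move ec: (dpda_start pre_dpda, w, [:: dpda_bottom pre_dpda]) acc => c acc.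
  case: acc ec => [p h pF [ep _ _]|c1 c2 c12 acc ec].
    by rewrite -ep inE in pF.
  have [idle _] := pre_dpda_sound acc; apply: idle.
  move: c12; rewrite -ec => /dpda_step_inv[_ [_ [p [s [[<- <-]]]]]].
  by case=> [[/= [<- <-] ->]|[? [? [//]]]].
- apply: DpdaAcceptsStep (init w) _; apply: pre_idle_complete => // a v ev.
  by apply: pre_pending_complete acc _ _ _ _ _; rewrite ev.
Qed.

End DpdaPreimage.

Lemma deterministic_context_free_preimage (U S : finType)
    (f : U -> option S) (L : language S) :
  deterministic_context_free L ->
  deterministic_context_free (pmap f @^-1` L).
Proof.
by move=> [M ->]; exists (pre_dpda f M); rewrite pre_dpda_language.
Qed.

(** * Closure properties of the two classes and the interleaved product *)

Lemma BDC_preimage (U S : finType) (f : U -> option S) (L : language S) :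
  BDC L -> BDC (pmap f @^-1` L).
Proof.
elim=> {L} [L dL|L1 L2 _ IH1 _ IH2|L1 L2 _ IH1 _ IH2|L _ IH].
- exact/BDC_dcf/deterministic_context_free_preimage.
- exact: BDC_union.
- exact: BDC_inter.
- exact: BDC_compl.
Qed.

Lemma BDC_setT (A : finType) : BDC (setT : language A).
Proof.
(* Any automaton would do: the full language is the union of a language and its complement. *)
pose M := @Dpda A unit unit tt tt finset.set0
  (fun _ _ _ => None) (fun _ _ _ _ => erefl).
rewrite -(setUv (dpda_language M)).
have BM : BDC (dpda_language M) by apply: BDC_dcf; exists M.
by apply: BDC_union => //; apply: BDC_compl.
Qed.

Lemma PCF_preimage (U S : finType) (f : U -> option S) (L : language S) :
  PCF L -> PCF (pmap f @^-1` L).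
Proof.
move=> [n [F [cF ->]]]; exists n, (fun i => pmap f @^-1` F i).
by split=> [i|]; [apply: context_free_preimage|rewrite preimage_bigcap].
Qed.

Lemma PCF_setT (A : finType) : PCF (setT : language A).
Proof.
exists 0, (fun=> set0); split=> [[]//|].
by apply/seteqP; split=> // w _ [].
Qed.

Lemma PCF_setI (A : finType) (L1 L2 : language A) :
  PCF L1 -> PCF L2 -> PCF (L1 `&` L2).
Proof.
move=> [m [F [cF ->]]] [n [F' [cF' ->]]].
exists (m + n), (fun i => match split i with inl j => F j | inr k => F' k end).
split=> [i|]; first by case: split.
apply/seteqP; split=> w /=.
- by move=> [Fw F'w] i _; case: split => j; [apply: Fw|apply: F'w].
- move=> Fw; split=> j _.
  + by have := Fw (unsplit (inl j)) I; rewrite unsplitK.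
  + by have := Fw (unsplit (inr j)) I; rewrite unsplitK.
Qed.

(** Shared by both classes; [P setT] covers the empty product [r = 0]. *)
Lemma interleaved_product_ind (K : choiceType) (r : nat)
    (Sigma : 'I_r -> {fset K}) (L : forall i : 'I_r, language (Sigma i))
    (P : language (alphabet_union Sigma) -> Prop) :
  P setT -> (forall L1 L2, P L1 -> P L2 -> P (L1 `&` L2)) ->
  (forall i, P (@proj K (alphabet_union Sigma) (Sigma i) @^-1` L i)) ->
  P (interleaved_product L).
Proof.
move=> PT PI PL.
suff -> : interleaved_product L =
    \big[setI/setT]_(i < r) (@proj K (alphabet_union Sigma) (Sigma i) @^-1` L i).
  by elim/big_ind: _.
rewrite -bigcap_seq; apply/seteqP; split=> w Lw i; first by move=> _; apply: Lw.
by apply: Lw; rewrite /= mem_index_enum.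
Qed.

Theorem proposition2p9 (K : choiceType) (r : nat) (Sigma : 'I_r -> {fset K})
    (L : forall i : 'I_r, language (Sigma i)) :
  ((forall i : 'I_r, BDC (L i)) -> BDC (interleaved_product L)) /\
  ((forall i : 'I_r, PCF (L i)) -> PCF (interleaved_product L)).
Proof.
split=> PL; apply: interleaved_product_ind.
- exact: BDC_setT.
- exact: BDC_inter.
- by move=> i; apply: (BDC_preimage (fun a => insub (val a))) (PL i).
- exact: PCF_setT.
- exact: PCF_setI.
- by move=> i; apply: (PCF_preimage (fun a => insub (val a))) (PL i).
Qed.
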